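(* $$\int_0^\infty \frac{\cos\beta x\,\sin\gamma x}{\cosh\delta x}\,\frac{dx}{x}=\tan^{-1}\frac{\sinh\left(\gamma\pi/(2\delta)\right)}{\cosh\left(\beta\pi/(2\delta)\right)}.$$
   Context: $\tan^{-1}$ denotes the arctangent function.
   Formalization: The identity is proved for real β, γ and δ > 0; no condition on δ is stated, but for δ = 0 the right side is undefined, and for δ < 0 with γ ≠ 0 it fails because the left side is even in δ and the right side is odd. *)

(* Defs.v *)
From Stdlib Require Export Reals.
From Coquelicot Require Export Coquelicot.

(* Main.v *)
Require Import Defs.
From Stdlib Require Import Reals Lra Psatz.
From Coquelicot Require Import Coquelicot.
Local Open Scope R_scope.

(** Differentiating [int_e^M cos(b x) sin(c x) / (x cosh x) dx] with respect to [c] leaves integrals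
    [int_e^M cos(a x) / cosh x dx] with [a = b + c] and [a = b - c]. These are within [e + 2/M] of
    [(PI/2) / cosh(a PI/2)], uniformly in [a], so the mean value theorem in [c] compares the truncated
    integral with the arctangent, whose derivative is the mean of the two limits; no exchange of
    limits is needed.
    Expanding [1/cosh x = 2 sum (-1)^n exp(-(2n+1) x)] reduces the cosine integral to the partial
    fractions [2 sum (-1)^n k/(k^2+a^2) = (PI/2) / cosh(a PI/2)], [k = 2n+1]. Since
    [(-1)^n k cosh(a PI/2)/(k^2+a^2) = int_0^(PI/2) cosh(a t) cos(k t) dt], the partial sums are integrals
    of [cosh(a t)] against the Dirichlet kernel [sin(2N t)/sin t], and the Leibniz series is the case
    [a = 0]. *)

(** * Elementary bounds for the hyperbolic functions and the sine *)

Lemma is_derive_sinh (x : R) : is_derive sinh x (cosh x).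
Proof. apply is_derive_Reals, derivable_pt_lim_sinh. Qed.

Lemma cosh_sinh_sq (x : R) : cosh x ^ 2 - sinh x ^ 2 = 1.
Proof.
  unfold cosh, sinh.
  assert (H : exp x * exp (- x) = 1) by (rewrite <- exp_plus, Rplus_opp_r; apply exp_0).
  nra.
Qed.

Lemma cosh_pos (x : R) : 0 < cosh x.
Proof. unfold cosh. pose proof (exp_pos x); pose proof (exp_pos (- x)); lra. Qed.

Lemma cosh_opp (x : R) : cosh (- x) = cosh x.
Proof. unfold cosh. rewrite Ropp_involutive; lra. Qed.

Lemma cosh_ge_1 (x : R) : 1 <= cosh x.
Proof. pose proof (cosh_sinh_sq x); pose proof (cosh_pos x); nra. Qed.

Lemma cosh_plus (x y : R) : cosh (x + y) = cosh x * cosh y + sinh x * sinh y.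
Proof.
  unfold cosh, sinh. rewrite Ropp_plus_distr, !exp_plus. field.
Qed.

Lemma cosh_minus (x y : R) : cosh (x - y) = cosh x * cosh y - sinh x * sinh y.
Proof.
  unfold Rminus; rewrite cosh_plus, cosh_opp.
  replace (sinh (- y)) with (- sinh y); [ring|].
  unfold sinh; rewrite Ropp_involutive; field.
Qed.

Lemma sinh_nonneg (x : R) : 0 <= x -> 0 <= sinh x.
Proof.
  intros [H | <-]; [|rewrite sinh_0; lra].
  rewrite <- sinh_0; left; apply sinh_lt, H.
Qed.

(** The difference [cosh y - cosh x] equals [2 * sinh ((x + y) / 2) * sinh ((y - x) / 2)], and the
    hypothesis makes both arguments nonnegative. *)
Lemma cosh_le (x y : R) : Rabs x <= y -> cosh x <= cosh y.
Proof.
  intros H; apply Rabs_le_between in H.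
  replace x with ((x + y) / 2 - (y - x) / 2) by field.
  replace y with ((x + y) / 2 + (y - x) / 2) at 3 by field.
  rewrite cosh_plus, cosh_minus.
  pose proof (sinh_nonneg ((x + y) / 2)); pose proof (sinh_nonneg ((y - x) / 2)).
  nra.
Qed.

Lemma sinh_ge_id (x : R) : 0 <= x -> x <= sinh x.
Proof.
  intros H.
  destruct (MVT_gen sinh 0 x cosh) as [c [Hc E]].
  - intros; apply is_derive_sinh.
  - intros y _; apply derivable_continuous_pt; eexists; apply derivable_pt_lim_sinh.
  - rewrite sinh_0 in E. pose proof (cosh_ge_1 c). nra.
Qed.

Lemma Rabs_sin_ge (t : R) : Rabs t <= PI / 2 -> Rabs t / 3 <= Rabs (sin t).
Proof.
  assert (pos : forall u, 0 <= u <= PI / 2 -> u / 3 <= sin u).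
  { intros u Hu. pose proof PI_4; pose proof PI_RGT_0.
    (* The Taylor bound [u - u ^ 3 / 6 <= sin u], with [u <= 2] from [PI <= 4], leaves at least
       [u / 3]. *)
    destruct (sin_bound u 0) as [B _]; [lra | lra |].
    unfold sin_approx, sin_term in B; simpl in B. nra. }
  intros H; apply Rabs_le_between in H.
  destruct (Rle_dec 0 t) as [p | n].
  - rewrite (Rabs_right t) by lra.
    eapply Rle_trans; [|apply Rle_abs]. apply pos; lra.
  - rewrite (Rabs_left t), <- (Rabs_Ropp (sin t)), <- sin_neg by lra.
    eapply Rle_trans; [|apply Rle_abs]. apply pos; lra.
Qed.

(** * The Dirichlet kernel for odd frequencies *)

(** The term of index [n] contributes [sin ((2n + 2) t) - sin (2n t)], so the sum telescopes.
    Multiplying by [sin t] keeps the identity valid at the zeros of the sine. *)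
Lemma sum_dirichlet (N : nat) (t : R) :
  sum_f_R0 (fun n => 2 * cos ((2 * INR n + 1) * t)) N * sin t = sin (2 * INR (S N) * t).
Proof.
  induction N as [|N IH].
  - simpl. replace (2 * 1 * t) with (2 * t) by ring. rewrite sin_2a.
    replace ((2 * 0 + 1) * t) with t by ring. ring.
  - rewrite tech5, Rmult_plus_distr_r, IH, (S_INR (S N)).
    set (m := 2 * INR (S N)).
    replace ((m + 1) * t) with (m * t + t) by ring.
    replace (2 * (INR (S N) + 1) * t) with (m * t + 2 * t) by (unfold m; ring).
    rewrite sin_plus, cos_plus, sin_2a, cos_2a_sin.
    ring.
Qed.

Lemma sin_half_pi_odd (n : nat) : sin ((2 * INR n + 1) * (PI / 2)) = (-1) ^ n.
Proof.
  induction n as [|n IH].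
  - simpl. replace ((2 * 0 + 1) * (PI / 2)) with (PI / 2) by ring. apply sin_PI2.
  - rewrite S_INR. simpl pow.
    replace ((2 * (INR n + 1) + 1) * (PI / 2)) with ((2 * INR n + 1) * (PI / 2) + PI) by field.
    rewrite neg_sin, IH. ring.
Qed.

Lemma cos_half_pi_odd (n : nat) : cos ((2 * INR n + 1) * (PI / 2)) = 0.
Proof.
  assert (E := sin2_cos2 ((2 * INR n + 1) * (PI / 2))).
  rewrite sin_half_pi_odd in E. unfold Rsqr in E.
  rewrite <- Rpow_mult_distr in E. replace (-1 * -1) with 1 in E by ring.
  rewrite pow1 in E. nra.
Qed.

Lemma is_RInt_sum_f_R0 (f : nat -> R -> R) (l : nat -> R) (a b : R) (N : nat) :
  (forall n, is_RInt (f n) a b (l n)) ->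
  is_RInt (fun x => sum_f_R0 (fun n => f n x) N) a b (sum_f_R0 l N).
Proof.
  intros H; induction N as [|N IH]; [apply H|].
  apply (is_RInt_plus (V := R_NormedModule)); [apply IH | apply H].
Qed.

(** Integrating by parts twice gives the antiderivative [F]. At [PI / 2] the cosine of an odd
    multiple vanishes and the sine is [(-1) ^ n]; at 0 both terms of [F] vanish. *)
Lemma is_RInt_cosh_cos (a : R) (n : nat) :
  is_RInt (fun t => cosh (a * t) * (2 * cos ((2 * INR n + 1) * t))) 0 (PI / 2)
    (cosh (a * (PI / 2)) * (2 * (-1) ^ n * ((2 * INR n + 1) / ((2 * INR n + 1) ^ 2 + a ^ 2)))).
Proof.
  set (k := 2 * INR n + 1).
  assert (Hk : 1 <= k) by (unfold k; pose proof (pos_INR n); lra).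
  assert (Hd : 0 < k ^ 2 + a ^ 2) by nra.
  set (F := fun t => 2 * (k * cosh (a * t) * sin (k * t) + a * sinh (a * t) * cos (k * t))
                     / (k ^ 2 + a ^ 2)).
  evar_last.
  - apply (is_RInt_derive F).
    + intros x _. unfold F, cosh, sinh. auto_derive; [trivial|].
      field. lra.
    + intros x _. apply (ex_derive_continuous (V := R_NormedModule)). unfold cosh. auto_derive; trivial.
  - unfold F, minus, plus, opp; simpl.
    rewrite !Rmult_0_r, sin_0, sinh_0.
    fold k. replace (sin (k * (PI / 2))) with ((-1) ^ n) by (symmetry; apply sin_half_pi_odd).
    replace (cos (k * (PI / 2))) with 0 by (symmetry; apply cos_half_pi_odd).
    field. lra.
Qed.

(** * The Leibniz series *)

Lemma is_lim_seq_inv_INR_S : is_lim_seq (fun n => / INR (S n)) 0.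
Proof.
  apply is_lim_seq_incr_1 with (u := fun n => / INR n).
  replace (Finite 0) with (Rbar_inv p_infty) by reflexivity.
  apply is_lim_seq_inv; [apply is_lim_seq_INR | discriminate].
Qed.

(** [Alt_PI] is four times the sum of the alternating series in [exist_PI], and [Alt_PI_eq]
    identifies it with [PI]. *)
Lemma is_lim_seq_leibniz :
  is_lim_seq (sum_f_R0 (fun n => 2 * (-1) ^ n / (2 * INR n + 1))) (PI / 2).
Proof.
  apply is_lim_seq_ext with (fun N => 2 * sum_f_R0 (tg_alt PI_tg) N).
  - intros N. rewrite scal_sum. apply sum_eq; intros n _.
    unfold tg_alt, PI_tg. rewrite plus_INR, mult_INR. simpl (INR 2); simpl (INR 1).
    replace (1+1) with 2 by ring. unfold Rdiv; ring.
  - replace (Finite (PI / 2)) with (Rbar_mult 2 (PI / 4)) by (simpl; f_equal; field).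
    apply is_lim_seq_scal_l, is_lim_seq_Reals.
    rewrite <- Alt_PI_eq. unfold Alt_PI.
    destruct exist_PI as [l Hl]; simpl.
    replace (4 * l / 4) with l by field. exact Hl.
Qed.

(** * A quantitative Riemann-Lebesgue estimate *)

Lemma ex_derive_continuity_pt (f : R -> R) (x : R) : ex_derive f x -> continuity_pt f x.
Proof. intros H; apply derivable_continuous_pt, ex_derive_Reals_0, H. Qed.

(** The mean value theorem is applied twice from 0: the second derivative [a ^ 2 * cosh (a * s)] is
    largest at [PI / 2], which bounds the first derivative linearly and then the function
    quadratically. These orders of vanishing compensate the later divisions by [sin t] and
    [sin t ^ 2]. *)
Lemma cosh_sub_1_bounds (a t : R) :
  Rabs t <= PI / 2 ->
  Rabs (a * sinh (a * t)) <= a ^ 2 * cosh (a * (PI / 2)) * Rabs t /\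
  Rabs (cosh (a * t) - 1) <= a ^ 2 * cosh (a * (PI / 2)) * t ^ 2.
Proof.
  set (A := a ^ 2 * cosh (a * (PI / 2))).
  assert (between : forall c u, Rmin 0 u <= c <= Rmax 0 u -> Rabs c <= Rabs u).
  { intros c u Hc. destruct (Rle_dec 0 u).
    - rewrite Rmin_left, Rmax_right in Hc by lra. rewrite !Rabs_right; lra.
    - rewrite Rmin_right, Rmax_left in Hc by lra. rewrite !Rabs_left1; lra. }
  assert (HA : 0 <= A) by (unfold A; pose proof (cosh_pos (a * (PI / 2))); nra).
  assert (sinh_bound : forall u, Rabs u <= PI / 2 -> Rabs (a * sinh (a * u)) <= A * Rabs u).
  { intros u Hu.
    destruct (MVT_gen (fun s => a * sinh (a * s)) 0 u (fun s => a ^ 2 * cosh (a * s)))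
      as [c [Hc E]].
    - intros; unfold sinh, cosh; auto_derive; [trivial | field].
    - intros x _. apply ex_derive_continuity_pt; unfold sinh; auto_derive; trivial.
    - rewrite Rmult_0_r, sinh_0, Rmult_0_r, !Rminus_0_r in E. rewrite E, Rabs_mult.
      apply Rmult_le_compat_r; [apply Rabs_pos|].
      rewrite Rabs_mult, (Rabs_right (a ^ 2)), (Rabs_right (cosh _)); cycle 1.
      + left; apply cosh_pos.
      + nra.
      + apply Rmult_le_compat_l; [nra|].
        pose proof (between _ _ Hc).
        assert (G : forall v, 0 <= v -> cosh (v * c) <= cosh (v * (PI / 2))).
        { intros v Hv. apply cosh_le. rewrite Rabs_mult, (Rabs_right v) by lra.
          apply Rmult_le_compat_l; lra. }
        destruct (Rle_dec 0 a); [now apply G|].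
        rewrite <- (cosh_opp (a * c)), <- (cosh_opp (a * (PI / 2))), !Ropp_mult_distr_l.
        apply G; lra. }
  intros Ht; split; [now apply sinh_bound|].
  destruct (MVT_gen (fun s => cosh (a * s)) 0 t (fun s => a * sinh (a * s)))
    as [c [Hc E]].
  - intros; unfold sinh, cosh; auto_derive; [trivial | field].
  - intros x _. apply ex_derive_continuity_pt; unfold cosh; auto_derive; trivial.
  - rewrite Rmult_0_r, cosh_0, Rminus_0_r in E. rewrite E, Rabs_mult.
    pose proof (between _ _ Hc).
    pose proof (sinh_bound c ltac:(lra)).
    rewrite <- pow2_abs. pose proof (Rabs_pos t).
    assert (0 <= A * Rabs t) by (apply Rmult_le_pos; assumption).
    apply Rle_trans with (A * Rabs c * Rabs t); [|nra].
    apply Rmult_le_compat_r; assumption.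
Qed.

(* With D the Dirichlet kernel and q = (cosh (a .) - 1) / sin, the function
   x |-> int_0^x (cosh (a t) - 1) D t dt + q x * cos (m x) / m has derivative
   q' x * cos (m x) / m, and q' stays bounded near 0. This is the integration by parts
   behind the Riemann-Lebesgue lemma. At x = 0 the junk value q 0 = 0 is the continuous one. *)
Lemma dirichlet_remainder_bound (a : R) (N : nat) (J : R) :
  is_RInt (fun t => (cosh (a * t) - 1) * sum_f_R0 (fun n => 2 * cos ((2 * INR n + 1) * t)) N)
    0 (PI / 2) J ->
  Rabs J <= a ^ 2 * cosh (a * (PI / 2)) * (15 * (PI / 2)) / (2 * INR (S N)).
Proof.
  intros HJ.
  set (D := fun t => sum_f_R0 (fun n => 2 * cos ((2 * INR n + 1) * t)) N) in *.
  set (f := fun t => (cosh (a * t) - 1) * D t).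
  set (m := 2 * INR (S N)). set (A := a ^ 2 * cosh (a * (PI / 2))).
  assert (Hm : 0 < m) by (unfold m; pose proof (lt_0_INR (S N) (Nat.lt_0_succ N)); lra).
  assert (HA : 0 <= A) by (unfold A; pose proof (cosh_pos (a * (PI / 2))); nra).
  pose proof PI_RGT_0 as HPI. pose proof PI_4 as HPI4.
  set (q := fun t => (cosh (a * t) - 1) / sin t).
  set (dq := fun t => (a * sinh (a * t) * sin t - (cosh (a * t) - 1) * cos t) / sin t ^ 2).
  assert (q0 : q 0 = 0) by (unfold q; rewrite Rmult_0_r, cosh_0; unfold Rdiv; ring).
  assert (qb : forall t, Rabs t <= PI / 2 -> Rabs (q t) <= 3 * A * Rabs t).
  { intros t Ht. destruct (Req_dec t 0) as [-> | nz].
    { rewrite q0, Rabs_R0; lra. }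
    pose proof (Rabs_sin_ge t Ht) as Hs.
    pose proof (proj2 (cosh_sub_1_bounds a t Ht)) as Hh. fold A in Hh.
    pose proof (Rabs_pos_lt t nz).
    unfold q, Rdiv. rewrite Rabs_mult, Rabs_inv.
    apply Rmult_le_reg_r with (Rabs (sin t)); [lra|].
    rewrite Rmult_assoc, Rinv_l, Rmult_1_r by lra.
    eapply Rle_trans; [exact Hh|]. rewrite <- pow2_abs.
    assert (0 <= A * Rabs t) by (apply Rmult_le_pos; lra). nra. }
  (* The constant 12 is 3 + 9: since [t <= 3 * sin t], the two terms of the numerator are at most
     [3 * A * sin t ^ 2] and [9 * A * sin t ^ 2]. *)
  assert (dqb : forall t, 0 < t <= PI / 2 -> Rabs (dq t) <= 12 * A).
  { intros t Ht.
    assert (Ht' : Rabs t <= PI / 2) by (rewrite Rabs_right; lra).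
    pose proof (Rabs_sin_ge t Ht') as Hs.
    destruct (cosh_sub_1_bounds a t Ht') as [H1 H2]. fold A in H1, H2.
    assert (sp : 0 < sin t) by (apply sin_gt_0; lra).
    rewrite (Rabs_right t) in * by lra. rewrite (Rabs_right (sin t)) in Hs by lra.
    unfold dq, Rdiv. rewrite Rabs_mult, Rabs_inv, (Rabs_right (sin t ^ 2)) by (apply Rle_ge, pow2_ge_0).
    apply Rmult_le_reg_r with (sin t ^ 2); [now apply pow_lt|].
    rewrite Rmult_assoc, Rinv_l, Rmult_1_r by (apply pow_nonzero; lra).
    unfold Rminus. eapply Rle_trans; [apply Rabs_triang|].
    rewrite Rabs_Ropp, Rabs_mult, (Rabs_mult (cosh _ + _)), (Rabs_right (sin t)) by lra.
    assert (Rabs (cos t) <= 1) by (apply Rabs_le; apply COS_bound).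
    assert (B1 : Rabs (a * sinh (a * t)) * sin t <= 3 * A * sin t ^ 2).
    { apply Rle_trans with (A * t * sin t); [nra|].
      assert (0 <= A * sin t) by nra. nra. }
    assert (B2 : Rabs (cosh (a * t) - 1) * Rabs (cos t) <= 9 * A * sin t ^ 2).
    { pose proof (Rabs_pos (cosh (a * t) - 1)).
      apply Rle_trans with (A * t ^ 2); [nra|].
      assert (t ^ 2 <= 9 * sin t ^ 2) by nra. nra. }
    unfold Rminus in B2. lra. }
  assert (cf : forall t, continuous f t).
  { intros t. apply (ex_derive_continuous (V := R_NormedModule)).
    apply (ex_derive_mult (fun t => cosh (a * t) - 1) D).
    - unfold cosh; auto_derive; trivial.
    - unfold D. apply ex_derive_ext with (fun t => sum_n (fun n => 2 * cos ((2 * INR n + 1) * t)) N).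
      { intros; apply sum_n_Reals. }
      apply (ex_derive_sum_n (V := R_NormedModule)). intros; auto_derive; trivial. }
  assert (fint : forall x, is_RInt f 0 x (RInt f 0 x)).
  { intros x; apply (RInt_correct (V := R_CompleteNormedModule)), (ex_RInt_continuous (V := R_CompleteNormedModule)).
    intros; apply cf. }
  set (Z := fun x => RInt f 0 x + q x * (cos (m * x) / m)).
  assert (dI : forall x, is_derive (fun x => RInt f 0 x) x (f x)).
  { intros x. apply (is_derive_RInt (V := R_NormedModule)) with 0; [|apply cf].
    apply filter_forall; exact fint. }
  assert (dZ : forall x, 0 < x <= PI / 2 -> is_derive Z x (dq x * (cos (m * x) / m))).
  { intros x Hx. assert (sp : 0 < sin x) by (apply sin_gt_0; lra).
    unfold Z. evar_last.
    - apply (is_derive_plus (V := R_NormedModule)); [apply dI|].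
      instantiate (1 := dq x * (cos (m * x) / m) - q x * sin (m * x)).
      unfold q, dq, cosh, sinh. auto_derive; [lra|]. field. lra.
    - unfold plus; simpl. unfold f.
      (* The Dirichlet identity [D x * sin x = sin (m * x)] makes the sine term from differentiating
         [cos (m * x) / m] cancel [f x]. *)
      replace (q x * sin (m * x)) with ((cosh (a * x) - 1) * D x).
      { ring. }
      unfold q, m. rewrite <- sum_dirichlet. fold (D x). field. lra. }
  assert (cZ : forall x, 0 <= x <= PI / 2 -> continuity_pt Z x).
  { intros x Hx. destruct (Req_dec x 0) as [-> | nz].
    - unfold Z. apply continuity_pt_plus.
      + apply ex_derive_continuity_pt.
        eexists; apply dI.
      + apply continuity_pt_mult.
        (* Continuity of [q] at 0 comes from the linear bound [qb]. A radius of at most 1 stays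
           below [PI / 2], and [3 * A + 1] is positive even when [A = 0]. *)
        * intros e He. exists (Rmin 1 (e / (3 * A + 1))). split.
          { apply Rmin_pos; [lra|]. apply Rdiv_lt_0_compat; lra. }
          intros t [_ Ht]. simpl in Ht |- *. unfold Rdist in *.
          rewrite q0. rewrite Rminus_0_r in *.
          pose proof (Rmin_l 1 (e / (3 * A + 1))). pose proof (Rmin_r 1 (e / (3 * A + 1))).
          pose proof PI2_1.
          eapply Rle_lt_trans; [apply qb; lra|].
          apply Rle_lt_trans with ((3 * A + 1) * Rabs t).
          { pose proof (Rabs_pos t). nra. }
          apply Rlt_le_trans with ((3 * A + 1) * (e / (3 * A + 1))).
          { apply Rmult_lt_compat_l; lra. }
          right; field; lra.
        * apply ex_derive_continuity_pt.
          auto_derive; lra.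
    - apply ex_derive_continuity_pt.
      eexists; apply dZ; lra. }
  (* Comparing [Z 0 = 0] with [Z (PI / 2)] gives [J = u * (PI / 2) - v]; the bounds [12 * A / m] on
     [u] and [3 * A * (PI / 2) / m] on [v] add up to the constant 15. *)
  destruct (MVT_gen Z 0 (PI / 2) (fun x => dq x * (cos (m * x) / m))) as [c [Hc E]].
  { rewrite Rmin_left, Rmax_right by lra. intros; apply dZ; lra. }
  { rewrite Rmin_left, Rmax_right by lra. exact cZ. }
  rewrite Rmin_left, Rmax_right in Hc by lra.
  assert (cosm : forall x, Rabs (cos (m * x) / m) <= / m).
  { intros x. unfold Rdiv. rewrite Rabs_mult, (Rabs_right (/ m)).
    - assert (Rabs (cos (m * x)) <= 1) by (apply Rabs_le; apply COS_bound).
      pose proof (Rinv_0_lt_compat m Hm). nra.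
    - left; apply Rinv_0_lt_compat, Hm. }
  assert (Z0 : Z 0 = 0).
  { unfold Z. rewrite q0, (RInt_point (V := R_CompleteNormedModule)). unfold zero; simpl; ring. }
  rewrite Z0, !Rminus_0_r in E. unfold Z in E.
  rewrite (is_RInt_unique _ _ _ _ HJ : RInt f 0 (PI / 2) = J) in E.
  set (u := dq c * (cos (m * c) / m)) in E.
  set (v := q (PI / 2) * (cos (m * (PI / 2)) / m)) in E.
  assert (im : 0 < / m) by (apply Rinv_0_lt_compat, Hm).
  assert (Hu : Rabs u <= 12 * A * / m).
  (* The mean value point may be the endpoint 0, where division by zero gives [dq 0 = 0]. *)
  { destruct (Req_dec c 0) as [-> | nz].
    - unfold u, dq. rewrite Rmult_0_r, cosh_0, sin_0.
      replace ((a * sinh 0 * 0 - (1 - 1) * cos 0) / 0 ^ 2) with 0 by (unfold Rdiv; ring).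
      rewrite Rmult_0_l, Rabs_R0. apply Rmult_le_pos; lra.
    - unfold u. rewrite Rabs_mult. apply Rmult_le_compat; try apply Rabs_pos; [|apply cosm].
      apply dqb; lra. }
  assert (Hv : Rabs v <= 3 * A * (PI / 2) * / m).
  { unfold v. rewrite Rabs_mult. apply Rmult_le_compat; try apply Rabs_pos; [|apply cosm].
    rewrite <- (Rabs_right (PI / 2)) at 2 by lra. apply qb. rewrite Rabs_right; lra. }
  replace J with (u * (PI / 2) - v) by lra.
  unfold Rminus. eapply Rle_trans; [apply Rabs_triang|].
  rewrite Rabs_Ropp, Rabs_mult, (Rabs_right (PI / 2)) by lra.
  apply Rle_trans with (12 * A * / m * (PI / 2) + 3 * A * (PI / 2) * / m).
  - apply Rplus_le_compat; [|exact Hv]. apply Rmult_le_compat_r; [lra|exact Hu].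
  - right; unfold Rdiv; ring.
Qed.

(** * Partial fractions of the hyperbolic secant *)

(** Multiplied by [c], the partial sum differs from that of the Leibniz series by the integral of
    [cosh (a * t) - 1] against the Dirichlet kernel, which is of order [1 / N]. *)
Lemma is_lim_seq_sech_partial_fractions (a : R) :
  is_lim_seq
    (sum_f_R0 (fun n => 2 * (-1) ^ n * ((2 * INR n + 1) / ((2 * INR n + 1) ^ 2 + a ^ 2))))
    (PI / 2 / cosh (a * (PI / 2))).
Proof.
  set (c := cosh (a * (PI / 2))). assert (cp : 0 < c) by apply cosh_pos.
  set (S1 := sum_f_R0 _).
  set (S0 := sum_f_R0 (fun n => 2 * (-1) ^ n / (2 * INR n + 1))).
  assert (bound : forall N, Rabs (c * S1 N - S0 N) <= a ^ 2 * c * (15 * (PI / 2)) / (2 * INR (S N))).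
  { intros N. apply dirichlet_remainder_bound.
    evar_last.
    - eapply is_RInt_ext; [|apply is_RInt_sum_f_R0; intros n;
        apply (is_RInt_minus (V := R_NormedModule));
        [apply (is_RInt_cosh_cos a n) | apply (is_RInt_cosh_cos 0 n)]].
      intros x _. simpl. rewrite scal_sum. apply sum_eq; intros n _.
      rewrite Rmult_0_l, cosh_0. unfold minus, plus, opp; simpl. ring.
    - simpl. fold c. unfold S1, S0. rewrite scal_sum, <- minus_sum.
      apply sum_eq; intros n _. rewrite Rmult_0_l, cosh_0. unfold minus, plus, opp; simpl.
      pose proof (pos_INR n). field. nra. }
  assert (L : is_lim_seq (fun N => c * S1 N - S0 N) 0).
  { apply is_lim_seq_abs_0.
    apply is_lim_seq_le_le with (fun _ => 0)
      (fun N => a ^ 2 * c * (15 * (PI / 2)) / 2 * / INR (S N)).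
    - intros N; split; [apply Rabs_pos|].
      eapply Rle_trans; [apply bound|]. right. field. apply not_0_INR; discriminate.
    - apply is_lim_seq_const.
    - replace (Finite 0) with (Rbar_mult (a ^ 2 * c * (15 * (PI / 2)) / 2) 0) by (simpl; f_equal; ring).
      apply is_lim_seq_scal_l.
      apply is_lim_seq_inv_INR_S. }
  apply is_lim_seq_ext with (fun N => / c * ((c * S1 N - S0 N) + S0 N)).
  { intros N; field; lra. }
  replace (Finite (PI / 2 / c)) with (Rbar_mult (/ c) (0 + PI / 2)) by (simpl; f_equal; field; lra).
  apply is_lim_seq_scal_l.
  apply is_lim_seq_plus'; [exact L | apply is_lim_seq_leibniz].
Qed.

(** * The truncated cosine transform of the hyperbolic secant *)

(** Multiplying the partial sum by [cosh x] makes it telescope, so the remainder is exactly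
    [(-1) ^ S N * r / cosh x]. This finite identity covers [x = 0], where the series itself
    diverges. *)
Lemma sech_geometric_remainder (x : R) (N : nat) :
  Rabs (/ cosh x - sum_f_R0 (fun n => 2 * (-1) ^ n * exp (- ((2 * INR n + 1) * x))) N)
  <= exp (- (2 * INR (S N) * x)).
Proof.
  pose proof (cosh_pos x); pose proof (cosh_ge_1 x).
  assert (E : sum_f_R0 (fun n => 2 * (-1) ^ n * exp (- ((2 * INR n + 1) * x))) N * cosh x
              = 1 - (-1) ^ S N * exp (- (2 * INR (S N) * x))).
  { assert (step : forall n, 2 * (-1) ^ n * exp (- ((2 * INR n + 1) * x)) * cosh x =
        (-1) ^ n * exp (- (2 * INR n * x)) - (-1) ^ S n * exp (- (2 * INR (S n) * x))).
    { intros n. unfold cosh. rewrite S_INR.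
      replace (- (2 * INR n * x)) with (- ((2 * INR n + 1) * x) + x) by ring.
      replace (- (2 * (INR n + 1) * x)) with (- ((2 * INR n + 1) * x) + - x) by ring.
      rewrite !exp_plus. simpl pow. field. }
    induction N as [|N IH].
    - etransitivity; [apply (step 0%nat)|].
      replace (- (2 * INR 0 * x)) with 0 by (simpl; ring). rewrite exp_0. ring.
    - rewrite tech5, Rmult_plus_distr_r, IH, step. ring. }
  set (s := sum_f_R0 _ N) in *. set (r := exp (- (2 * INR (S N) * x))) in *.
  assert (0 < r) by apply exp_pos.
  replace (/ cosh x - s) with ((-1) ^ S N * r / cosh x).
  - unfold Rdiv. rewrite !Rabs_mult, pow_1_abs, Rabs_inv, (Rabs_right r), (Rabs_right (cosh x)) by lra.
    rewrite Rmult_1_l. apply Rmult_le_reg_r with (cosh x); [lra|].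
    rewrite Rmult_assoc, Rinv_l by lra. nra.
  - apply Rmult_eq_reg_r with (cosh x); [|lra].
    rewrite Rmult_minus_distr_r, E, Rinv_l by lra. field. lra.
Qed.

(** The value is split into the half-line integral, which builds the partial fractions, and the
    boundary term at [M], which goes into the error. *)
Lemma is_RInt_cos_exp (a k M : R) :
  0 < k ->
  is_RInt (fun x => cos (a * x) * exp (- (k * x))) 0 M
    (k / (k ^ 2 + a ^ 2) - exp (- (k * M)) * (k * cos (a * M) - a * sin (a * M)) / (k ^ 2 + a ^ 2)).
Proof.
  intros Hk. assert (Hd : 0 < k ^ 2 + a ^ 2) by nra.
  evar_last.
  - apply (is_RInt_derive
      (fun x => - (exp (- (k * x)) * (k * cos (a * x) - a * sin (a * x)) / (k ^ 2 + a ^ 2)))).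
    + intros x _. auto_derive; [trivial|]. field. lra.
    + intros x _. apply (ex_derive_continuous (V := R_NormedModule)). auto_derive; trivial.
  - unfold minus, plus, opp; simpl. rewrite !Rmult_0_r, Ropp_0, exp_0, sin_0, cos_0.
    field. nra.
Qed.

Lemma ex_RInt_cos_sech (a u v : R) : ex_RInt (fun x => cos (a * x) / cosh x) u v.
Proof.
  apply (ex_RInt_continuous (V := R_CompleteNormedModule)). intros x _.
  apply (ex_derive_continuous (V := R_NormedModule)).
  pose proof (cosh_pos x). unfold cosh in *. auto_derive. lra.
Qed.

(** Two errors are separated: [tail], from cutting the series, tends to 0 with [N]; [trunc], from
    stopping the integrals [I n] at [M], is bounded uniformly in [N] and [a]. Then [N] tends to
    infinity. *)
Lemma RInt_cos_sech_approx (a M : R) :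
  0 < M ->
  Rabs (RInt (fun x => cos (a * x) / cosh x) 0 M - PI / 2 / cosh (a * (PI / 2))) <= 2 / M.
Proof.
  intros HM.
  set (G := RInt _ 0 M).
  set (P := sum_f_R0 (fun n => 2 * (-1) ^ n * ((2 * INR n + 1) / ((2 * INR n + 1) ^ 2 + a ^ 2)))).
  set (I := fun n => (2 * INR n + 1) / ((2 * INR n + 1) ^ 2 + a ^ 2)
    - exp (- ((2 * INR n + 1) * M)) * ((2 * INR n + 1) * cos (a * M) - a * sin (a * M))
      / ((2 * INR n + 1) ^ 2 + a ^ 2)).
  assert (tail : forall N, Rabs (G - sum_f_R0 (fun n => 2 * (-1) ^ n * I n) N) <= / 2 * / INR (S N)).
  { intros N. set (m := 2 * INR (S N)).
    assert (0 < INR (S N)) by (apply lt_0_INR; lia).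
    assert (Hm : 0 < m) by (unfold m; lra).
    apply Rle_trans with ((1 - exp (- (m * M))) / m).
    - apply (norm_RInt_le (V := R_NormedModule)
        (fun x => cos (a * x) / cosh x
           - sum_f_R0 (fun n => 2 * (-1) ^ n * (cos (a * x) * exp (- ((2 * INR n + 1) * x)))) N)
        (fun x => exp (- (m * x))) 0 M); [lra | | |].
      + intros x Hx. change norm with Rabs.
        replace (cos (a * x) / cosh x - sum_f_R0 _ N)
          with (cos (a * x) * (/ cosh x
                 - sum_f_R0 (fun n => 2 * (-1) ^ n * exp (- ((2 * INR n + 1) * x))) N)).
        * rewrite Rabs_mult. pose proof (sech_geometric_remainder x N) as B. fold m in B.
          assert (Rabs (cos (a * x)) <= 1) by (apply Rabs_le; apply COS_bound).
          pose proof (Rabs_pos (cos (a * x))). pose proof (exp_pos (- (m * x))).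
          eapply Rle_trans; [apply Rmult_le_compat_l; [assumption | exact B]|]. nra.
        * rewrite Rmult_minus_distr_l. f_equal. rewrite scal_sum. apply sum_eq; intros; ring.
      + apply (is_RInt_minus (V := R_NormedModule)).
        * apply (RInt_correct (V := R_CompleteNormedModule)), ex_RInt_cos_sech.
        * apply is_RInt_sum_f_R0. intros n.
          apply (is_RInt_scal (V := R_NormedModule)), is_RInt_cos_exp.
          pose proof (pos_INR n); lra.
      + evar_last.
        * apply (is_RInt_derive (fun x => - (exp (- (m * x)) / m))).
          -- intros x _. auto_derive; [trivial|]. field. lra.
          -- intros x _. apply (ex_derive_continuous (V := R_NormedModule)). auto_derive; trivial.
        * unfold minus, plus, opp; simpl. rewrite Rmult_0_r, Ropp_0, exp_0. field. lra.
    - pose proof (exp_pos (- (m * M))).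
      rewrite <- Rinv_mult. fold m. unfold Rdiv.
      pose proof (Rinv_0_lt_compat m Hm). nra. }
  assert (trunc : forall N, Rabs (sum_f_R0 (fun n => 2 * (-1) ^ n * I n) N - P N) <= 2 / M).
  { intros N. unfold P. rewrite <- minus_sum.
    apply Rle_trans with (sum_f_R0 (fun n => 4 * exp (- ((2 * INR n + 1) * M))) N).
    - eapply Rle_trans; [apply Rsum_abs|]. apply sum_Rle. intros n _.
      set (k := 2 * INR n + 1). assert (Hk : 1 <= k) by (unfold k; pose proof (pos_INR n); lra).
      assert (Hd : 0 < k ^ 2 + a ^ 2) by nra.
      unfold I. fold k.
      match goal with |- Rabs ?e <= _ =>
        replace e with ((-1) ^ n * (- (2 * exp (- (k * M)))
          * ((k * cos (a * M) - a * sin (a * M)) / (k ^ 2 + a ^ 2)))) by (field; lra) end.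
      rewrite Rabs_mult, pow_1_abs, Rmult_1_l, Rabs_mult, Rabs_Ropp.
      pose proof (exp_pos (- (k * M))).
      rewrite (Rabs_right (2 * _)) by lra.
      (* As [k >= 1], both [k <= k ^ 2] and [2 * |a| <= k ^ 2 + a ^ 2] hold, so
         [k + |a| <= 2 * (k ^ 2 + a ^ 2)]. *)
      assert (Rabs ((k * cos (a * M) - a * sin (a * M)) / (k ^ 2 + a ^ 2)) <= 2); [|nra].
      unfold Rdiv. rewrite Rabs_mult, Rabs_inv, (Rabs_right (k ^ 2 + a ^ 2)) by lra.
      apply Rmult_le_reg_r with (k ^ 2 + a ^ 2); [lra|].
      rewrite Rmult_assoc, Rinv_l, Rmult_1_r by lra.
      unfold Rminus. eapply Rle_trans; [apply Rabs_triang|].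
      rewrite Rabs_Ropp, !Rabs_mult, (Rabs_right k) by lra.
      assert (Rabs (cos (a * M)) <= 1) by (apply Rabs_le; apply COS_bound).
      assert (Rabs (sin (a * M)) <= 1) by (apply Rabs_le; apply SIN_bound).
      rewrite <- (pow2_abs a). pose proof (Rabs_pos a).
      assert (k * Rabs (cos (a * M)) <= k) by nra.
      assert (Rabs a * Rabs (sin (a * M)) <= Rabs a) by nra.
      pose proof (pow2_ge_0 (Rabs a - 1)). pose proof (pow2_ge_0 (k - 1)).
      pose proof (pow2_ge_0 (Rabs a)). lra.
    (* The geometric sum telescopes against [sinh M] and is at most [2 / sinh M], hence at most
       [2 / M]. *)
    - assert (tel : sum_f_R0 (fun n => 4 * exp (- ((2 * INR n + 1) * M))) N * sinh M
                    = 2 * (1 - exp (- (2 * INR (S N) * M)))).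
      { assert (step : forall n, 4 * exp (- ((2 * INR n + 1) * M)) * sinh M =
            2 * (exp (- (2 * INR n * M)) - exp (- (2 * INR (S n) * M)))).
        { intros n. unfold sinh. rewrite S_INR.
          replace (- (2 * INR n * M)) with (- ((2 * INR n + 1) * M) + M) by ring.
          replace (- (2 * (INR n + 1) * M)) with (- ((2 * INR n + 1) * M) + - M) by ring.
          rewrite !exp_plus. field. }
        induction N as [|N IH].
        - etransitivity; [apply (step 0%nat)|].
          replace (- (2 * INR 0 * M)) with 0 by (simpl; ring). rewrite exp_0. ring.
        - rewrite tech5, Rmult_plus_distr_r, IH, step. ring. }
      pose proof (exp_pos (- (2 * INR (S N) * M))).
      pose proof (sinh_ge_id M ltac:(lra)).
      set (s := sum_f_R0 _ N) in *.
      assert (0 <= s) by (apply cond_pos_sum; intros n; pose proof (exp_pos (- ((2 * INR n + 1) * M))); lra).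
      apply Rmult_le_reg_r with M; [exact HM|].
      unfold Rdiv. rewrite Rmult_assoc, Rinv_l by lra. nra. }
  assert (L : is_lim_seq (fun N => Rabs (G - P N)) (Rabs (G - PI / 2 / cosh (a * (PI / 2))))).
  { apply (is_lim_seq_abs _ (Finite _)). apply is_lim_seq_minus'; [apply is_lim_seq_const|].
    apply is_lim_seq_sech_partial_fractions. }
  assert (L' : is_lim_seq (fun N => / 2 * / INR (S N) + 2 / M) (0 + 2 / M)).
  { apply is_lim_seq_plus'; [|apply is_lim_seq_const].
    replace (Finite 0) with (Rbar_mult (/ 2) 0) by (simpl; f_equal; ring).
    apply is_lim_seq_scal_l.
    apply is_lim_seq_inv_INR_S. }
  rewrite Rplus_0_l in L'.
  refine (is_lim_seq_le _ _ (Finite _) (Finite _) _ L L'). intros N.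
  replace (G - P N) with ((G - sum_f_R0 (fun n => 2 * (-1) ^ n * I n) N)
    + (sum_f_R0 (fun n => 2 * (-1) ^ n * I n) N - P N)) by ring.
  eapply Rle_trans; [apply Rabs_triang|]. apply Rplus_le_compat; [apply tail | apply trunc].
Qed.

(** The integrand is at most 1 in absolute value, so removing the interval from 0 to [e] costs at
    most [e]. *)
Lemma RInt_cos_sech_approx_from (a e M : R) :
  0 < e -> 0 < M ->
  Rabs (RInt (fun x => cos (a * x) / cosh x) e M - PI / 2 / cosh (a * (PI / 2))) <= e + 2 / M.
Proof.
  intros He HM.
  set (f := fun x => cos (a * x) / cosh x).
  pose proof (RInt_cos_sech_approx a M HM) as B. fold f in B.
  pose proof (RInt_Chasles (V := R_CompleteNormedModule) f 0 e M
    (ex_RInt_cos_sech a 0 e) (ex_RInt_cos_sech a e M)) as C.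
  change plus with Rplus in C.
  assert (S : Rabs (RInt f 0 e) <= (e - 0) * 1).
  { apply abs_RInt_le_const; [lra | apply ex_RInt_cos_sech|].
    intros t _. unfold f, Rdiv. rewrite Rabs_mult, Rabs_inv.
    pose proof (cosh_ge_1 t). rewrite (Rabs_right (cosh t)) by lra.
    assert (Rabs (cos (a * t)) <= 1) by (apply Rabs_le; apply COS_bound).
    apply Rmult_le_reg_r with (cosh t); [lra|]. rewrite Rmult_assoc, Rinv_l by lra. lra. }
  apply Rabs_le_between in B. apply Rabs_le_between in S.
  apply Rabs_le. lra.
Qed.

(** * Differentiation in the sine parameter and comparison with the arctangent *)

(** The factor [x] produced by differentiating [sin (c * x)] cancels [/ x]; starting at [e > 0]
    keeps the integrand regular. *)
Lemma is_derive_RInt_sin_param (b c e M : R) :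
  0 < e -> e <= M ->
  is_derive (fun c => RInt (fun x => cos (b * x) * sin (c * x) / cosh x * / x) e M) c
    (RInt (fun x => cos (b * x) * cos (c * x) / cosh x) e M).
Proof.
  intros He HM.
  assert (D : forall u t, is_derive (fun z => cos (b * t) * sin (z * t) / cosh t * / t) u
                            (cos (b * t) * (t * cos (u * t)) / cosh t * / t)).
  { intros u t. auto_derive; [trivial|]. unfold Rdiv. ring. }
  evar_last.
  - apply (is_derive_RInt_param (fun c x => cos (b * x) * sin (c * x) / cosh x * / x) e M c).
    + apply filter_forall. intros u t _. eexists; apply D.
    + rewrite Rmin_left, Rmax_right by lra. intros t Ht.
      apply continuity_2d_pt_ext with
        (fun u v => cos (b * v) * (v * cos (u * v)) * / cosh v * / v).
      { intros u v. symmetry. apply is_derive_unique, D. }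
      repeat apply continuity_2d_pt_mult.
      * apply (continuity_1d_2d_pt_comp (fun v => cos (b * v)) (fun _ v => v)).
        { apply ex_derive_continuity_pt; auto_derive; trivial. }
        apply continuity_2d_pt_id2.
      * apply continuity_2d_pt_id2.
      * apply (continuity_1d_2d_pt_comp cos (fun u v => u * v)).
        { apply continuity_cos. }
        apply continuity_2d_pt_mult; [apply continuity_2d_pt_id1 | apply continuity_2d_pt_id2].
      * apply (continuity_1d_2d_pt_comp (fun v => / cosh v) (fun _ v => v)).
        { apply ex_derive_continuity_pt. pose proof (cosh_pos t). unfold cosh in *. auto_derive. lra. }
        apply continuity_2d_pt_id2.
      * apply continuity_2d_pt_inv; [apply continuity_2d_pt_id2 | lra].
    + apply filter_forall. intros u.
      apply (ex_RInt_continuous (V := R_CompleteNormedModule)).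
      rewrite Rmin_left, Rmax_right by lra. intros x Hx.
      apply (ex_derive_continuous (V := R_NormedModule)).
      pose proof (cosh_pos x). unfold cosh in *. auto_derive. split; [lra|]. split; [lra|trivial].
  - apply RInt_ext. rewrite Rmin_left, Rmax_right by lra. intros x Hx.
    etransitivity; [apply is_derive_unique, D|]. pose proof (cosh_pos x).
    match goal with |- ?u = ?v => change (@eq R u v) end. field. lra.
Qed.

(** Both functions of [c] vanish at 0, and their derivatives differ by at most [e + 2 / M]
    everywhere. *)
Lemma RInt_cos_sin_sech_approx (b c e M : R) :
  0 < e -> e <= M ->
  Rabs (RInt (fun x => cos (b * x) * sin (c * x) / cosh x * / x) e M
        - atan (sinh (c * (PI / 2)) / cosh (b * (PI / 2)))) <= (e + 2 / M) * Rabs c.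
Proof.
  intros He HM.
  set (Psi := fun c => RInt (fun x => cos (b * x) * sin (c * x) / cosh x * / x) e M).
  set (T := fun a => PI / 2 / cosh (a * (PI / 2))).
  set (At := fun c => atan (sinh (c * (PI / 2)) / cosh (b * (PI / 2)))).
  assert (dAt : forall c, is_derive At c ((T (b + c) + T (b - c)) / 2)).
  { intros u. unfold At.
    set (C := cosh (b * (PI / 2))). assert (HC : 0 < C) by apply cosh_pos.
    evar_last.
    - apply (is_derive_comp atan (fun c => sinh (c * (PI / 2)) / C)).
      + apply is_derive_atan.
      + instantiate (1 := PI / 2 * cosh (u * (PI / 2)) / C).
        unfold sinh, cosh. auto_derive; [trivial|]. field. lra.
    - unfold scal; simpl; unfold mult; simpl. unfold T.
      rewrite Rmult_plus_distr_r, Rmult_minus_distr_r.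
      pose proof (cosh_pos (b * (PI / 2) + u * (PI / 2))) as P1.
      pose proof (cosh_pos (b * (PI / 2) - u * (PI / 2))) as P2.
      rewrite cosh_plus in *. rewrite cosh_minus in *. fold C in P1, P2 |- *.
      pose proof (cosh_sinh_sq (b * (PI / 2))) as E1. fold C in E1.
      pose proof (cosh_sinh_sq (u * (PI / 2))) as E2.
      set (S := sinh (b * (PI / 2))) in *. set (s := sinh (u * (PI / 2))) in *.
      set (k := cosh (u * (PI / 2))) in *.
      (* The product of the two shifted [cosh] values is the denominator left by [1 + (s / C) ^ 2]
         in the derivative of [atan]; their sum is [2 * C * k]. *)
      assert (E : (C * k + S * s) * (C * k - S * s) = C ^ 2 + s ^ 2).
      { replace ((C * k + S * s) * (C * k - S * s)) with (C ^ 2 * k ^ 2 - S ^ 2 * s ^ 2) by ring.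
        replace (k ^ 2) with (1 + s ^ 2) by lra. replace (S ^ 2) with (C ^ 2 - 1) by lra. ring. }
      assert (0 < C ^ 2 + s ^ 2) by nra.
      transitivity (PI / 2 * (C * k) / (C ^ 2 + s ^ 2)).
      + unfold Rsqr. field. nra.
      + rewrite <- E. field. lra. }
  assert (dPsi : forall c, is_derive Psi c (RInt (fun x => cos (b * x) * cos (c * x) / cosh x) e M)).
  { intros u. apply is_derive_RInt_sin_param; assumption. }
  assert (close : forall u, Rabs (RInt (fun x => cos (b * x) * cos (u * x) / cosh x) e M
                                  - (T (b + u) + T (b - u)) / 2) <= e + 2 / M).
  { intros u.
    assert (E : RInt (fun x => cos (b * x) * cos (u * x) / cosh x) e M
      = / 2 * (RInt (fun x => cos ((b + u) * x) / cosh x) e M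
               + RInt (fun x => cos ((b - u) * x) / cosh x) e M)).
    { apply is_RInt_unique.
      eapply is_RInt_ext;
        [|apply (is_RInt_scal (V := R_NormedModule)), (is_RInt_plus (V := R_NormedModule));
          apply (RInt_correct (V := R_CompleteNormedModule)), ex_RInt_cos_sech].
      intros x _. unfold plus, scal; simpl. unfold mult; simpl.
      rewrite Rmult_plus_distr_r, Rmult_minus_distr_r, cos_plus, cos_minus.
      pose proof (cosh_pos x). field. lra. }
    rewrite E.
    pose proof (RInt_cos_sech_approx_from (b + u) e M He ltac:(lra)) as B1.
    pose proof (RInt_cos_sech_approx_from (b - u) e M He ltac:(lra)) as B2.
    fold (T (b + u)) in B1. fold (T (b - u)) in B2.
    apply Rabs_le_between in B1. apply Rabs_le_between in B2. apply Rabs_le. lra. }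
  assert (dd : forall u, is_derive (fun c => Psi c - At c) u
     (RInt (fun x => cos (b * x) * cos (u * x) / cosh x) e M - (T (b + u) + T (b - u)) / 2)).
  { intros u. apply (is_derive_minus (V := R_NormedModule)); [apply dPsi | apply dAt]. }
  destruct (MVT_gen (fun c => Psi c - At c) 0 c _ (fun u _ => dd u)) as [u [_ E]].
  { intros x _. apply ex_derive_continuity_pt. eexists; apply dd. }
  assert (Z1 : At 0 = 0).
  { unfold At. rewrite Rmult_0_l, sinh_0. unfold Rdiv. rewrite Rmult_0_l. apply atan_0. }
  assert (Z2 : Psi 0 = 0).
  { unfold Psi. rewrite (RInt_ext _ (fun _ => 0)).
    - rewrite (RInt_const (V := R_CompleteNormedModule)). apply Rmult_0_r.
    - intros x _. unfold Rdiv. rewrite Rmult_0_l, sin_0, Rmult_0_r, !Rmult_0_l. reflexivity. }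
  rewrite Z1, Z2, !Rminus_0_r in E.
  change (Rabs (Psi c - At c) <= (e + 2 / M) * Rabs c).
  rewrite E, Rabs_mult. apply Rmult_le_compat_r; [apply Rabs_pos | apply close].
Qed.

(** * Rescaling by [delta] and the improper integral *)

Theorem mainTheorem7 :
  forall beta gamma delta : R, 0 < delta ->
    is_RInt_gen
      (fun x : R => cos (beta * x) * sin (gamma * x) / cosh (delta * x) * / x)
      (at_right 0) (Rbar_locally p_infty)
      (atan (sinh (gamma * PI / (2 * delta)) / cosh (beta * PI / (2 * delta)))).
Proof.
  intros beta gamma delta Hd.
  (* The measure [dx / x] is invariant under scaling, so the substitution [y = delta * x] reduces to
     [delta = 1] with these parameters. *)
  set (b := beta / delta). set (c := gamma / delta).
  replace (gamma * PI / (2 * delta)) with (c * (PI / 2)) by (unfold c; field; lra).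
  replace (beta * PI / (2 * delta)) with (b * (PI / 2)) by (unfold b; field; lra).
  set (A := atan _).
  set (f := fun x => cos (b * x) * sin (c * x) / cosh x * / x).
  intros P [eps HP].
  (* Both [e] and [2 / M], after rescaling, will be below [eta], for an error of at most
     [2 * eta * |c| < eps]; the added 1 covers [c = 0]. *)
  set (eta := eps / (2 * (Rabs c + 1))).
  pose proof (Rabs_pos c) as Hc. pose proof (cond_pos eps) as Heps.
  assert (Heta : 0 < eta) by (apply Rdiv_lt_0_compat; lra).
  assert (Heta' : 0 < Rmin 1 eta / delta).
  { apply Rdiv_lt_0_compat; [apply Rmin_pos; lra | exact Hd]. }
  (* The thresholds are divided by [delta] to undo the scaling; the entries 1 force
     [delta * e < 1 < delta * M], so the limits are ordered. *)
  apply Filter_prod with (fun e => 0 < e < Rmin 1 eta / delta)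
                         (fun M => Rmax 1 (2 / eta) / delta < M).
  - exists (mkposreal _ Heta'). intros y Hy Hy0. split; [exact Hy0|].
    change (Rabs (y - 0) < Rmin 1 eta / delta) in Hy.
    rewrite Rminus_0_r in Hy. rewrite Rabs_right in Hy; lra.
  - exists (Rmax 1 (2 / eta) / delta). trivial.
  - intros e M [He1 He2] HM. simpl.
    apply Rlt_div_r in He2; [|exact Hd]. apply Rlt_div_l in HM; [|exact Hd].
    pose proof (Rmin_l 1 eta). pose proof (Rmin_r 1 eta).
    pose proof (Rmax_l 1 (2 / eta)). pose proof (Rmax_r 1 (2 / eta)).
    assert (He : 0 < delta * e) by (apply Rmult_lt_0_compat; assumption).
    assert (HeM : delta * e <= delta * M) by lra.
    exists (RInt f (delta * e) (delta * M)). split.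
    + apply is_RInt_ext with (fun y => scal delta (f (delta * y + 0))).
      * rewrite Rmin_left, Rmax_right by nra. intros x Hx.
        unfold f, b, c, scal; simpl; unfold mult; simpl. rewrite Rplus_0_r.
        replace (beta / delta * (delta * x)) with (beta * x) by (field; lra).
        replace (gamma / delta * (delta * x)) with (gamma * x) by (field; lra).
        pose proof (cosh_pos (delta * x)). field. lra.
      * apply (is_RInt_comp_lin (V := R_NormedModule)). rewrite !Rplus_0_r.
        apply (RInt_correct (V := R_CompleteNormedModule)), (ex_RInt_continuous (V := R_CompleteNormedModule)).
        rewrite Rmin_left, Rmax_right by exact HeM. intros x Hx.
        apply (ex_derive_continuous (V := R_NormedModule)). unfold f.
        pose proof (cosh_pos x). unfold cosh in *. auto_derive. split; [lra|]. split; [lra|trivial].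
    + apply HP. change (Rabs (RInt f (delta * e) (delta * M) - A) < eps).
      eapply Rle_lt_trans; [apply RInt_cos_sin_sech_approx; assumption|].
      assert (2 / (delta * M) < eta).
      { apply Rlt_div_l; [lra|].
        apply Rlt_le_trans with (eta * (M * delta)); [|right; ring].
        apply Rle_lt_trans with (eta * (2 / eta)); [right; field; lra|].
        apply Rmult_lt_compat_l; lra. }
      apply Rle_lt_trans with (2 * eta * Rabs c); [apply Rmult_le_compat_r; lra|].
      apply Rlt_le_trans with (2 * eta * (Rabs c + 1)); [nra|].
      right. unfold eta. field. lra.
Qed.
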